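(* Let $n=2$, $m_1,m_2\ge 2$ and $m_*=\min\{m_1,m_2\}$. For any $k\in\{1,\dots,m_*\}$, $$\Pr\left[\text{the clockwork best-response dynamic on } G_{2,\mathbf{m}} \text{ converges to a } 2k\text{-cycle}\right]=\sum_{t=1}^{2(m_*-k+1)}\frac{1}{m_{s_{\texttt{c}}(t+2k-1)}}\prod_{i=1}^{t+2k-2}\left(1-\frac{1}{m_{s_{\texttt{c}}(i)}}\left\lfloor\frac{i}{2}\right\rfloor\right).$$
   Context: A random 2-player game $G_{2,\mathbf{m}}$: player $i\in\{1,2\}$ has actions $[m_i]=\{1,\dots,m_i\}$; $\mathcal{M}=[m_1]\times[m_2]$. Payoffs $U_i(\mathbf{a})$ are drawn independently from a fixed atomless distribution on $\mathbb{R}$; the best response $B_i(a_{-i})=\arg\max_{x\in[m_i]}U_i(x,a_{-i})$ is a.s. unique. The clockwork sequence is $s_{\texttt{c}}(t)=1+((t-1)\bmod 2)$. The clockwork best-response dynamic: $\mathbf{A}^0$ uniform on $\mathcal{M}$ independent of payoffs; for $t\ge 1$ with $i=s_{\texttt{c}}(t)$, $A^t_{-i}=A^{t-1}_{-i}$ and $A^t_i=B_i(A^{t-1}_{-i})$. The dynamic converges to a $2k$-cycle (at time $t$) if $t=\inf\{\tau\ge 1:\mathbf{A}^\tau=\mathbf{A}^{\tau+2k}\text{ and }\mathbf{A}^\tau\ne\mathbf{A}^{\tau+2k'}\text{ for all }k'\in\{1,\dots,k-1\}\}$ is finite; $k=1$ corresponds to convergence to a pure Nash equilibrium. *)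

(* Defs.v *)
From HB Require Import structures.
From mathcomp Require Import all_boot all_order all_algebra.
From mathcomp Require Import all_classical all_reals all_analysis.
Set Implicit Arguments. Unset Strict Implicit. Unset Printing Implicit Defensive.
Import Order.TTheory GRing.Theory Num.Theory.
Local Open Scope classical_set_scope.
Local Open Scope ring_scope.

Section Game.
Variables (R : realType) (m1 m2 : nat).

Definition profile := ('I_m1 * 'I_m2)%type.

(* best response of player 1 to y : a maximiser of x |-> U_1(x,y).
   The argument x0 is only used to witness non-emptiness (and to break
   ties, which a.s. do not occur). *)
Definition br1 (pay1 : 'I_m1 -> 'I_m2 -> R) (x0 : 'I_m1) (y : 'I_m2) : 'I_m1 :=
  [arg max_(x > x0) pay1 x y]%O.
Definition br2 (pay2 : 'I_m1 -> 'I_m2 -> R) (y0 : 'I_m2) (x : 'I_m1) : 'I_m2 :=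
  [arg max_(y > y0) pay2 x y]%O.

Definition sc (t : nat) : nat := (1 + (t - 1) %% 2)%N.

Fixpoint clockwork (pay1 pay2 : 'I_m1 -> 'I_m2 -> R) (a0 : profile) (t : nat)
  : profile :=
  match t with
  | 0 => a0
  | t'.+1 =>
      let a := clockwork pay1 pay2 a0 t' in
      if sc t'.+1 == 1%N then (br1 pay1 a.1 a.2, a.2)
      else (a.1, br2 pay2 a.2 a.1)
  end.

(* the dynamic converges to a 2k-cycle: the infimum
   inf{tau >= 1 : A^tau = A^(tau+2k) and A^tau <> A^(tau+2k') for 1 <= k' <= k-1}
   is finite, i.e. the set is nonempty *)
Definition converges_to_cycle (A : nat -> profile) (k : nat) : Prop :=
  exists tau : nat, [/\ (1 <= tau)%N, A tau = A (tau + 2 * k)%N &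
    forall k' : nat, (1 <= k')%N -> (k' <= k - 1)%N -> A tau <> A (tau + 2 * k')%N].

End Game.

Section Prob.
Context {d : measure_display} {T : measurableType d} {R : realType}.
Local Open Scope ereal_scope.

(* mutual independence of the payoff variables U_1(a), U_2(a) (a in M)
   and of the initial profile A0: product rule for every choice of events
   (choosing setT for some of them gives every subfamily). *)
Definition game_independent (m1 m2 : nat) (P : probability T R)
  (U1 U2 : 'I_m1 -> 'I_m2 -> T -> R) (A0 : T -> ('I_m1 * 'I_m2)%type) : Prop :=
  forall (B1 B2 : 'I_m1 -> 'I_m2 -> set R) (S : set ('I_m1 * 'I_m2)),
    (forall i j, measurable (B1 i j)) -> (forall i j, measurable (B2 i j)) ->
    P (\big[setI/setT]_(i < m1) \big[setI/setT]_(j < m2)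
          (U1 i j @^-1` B1 i j `&` U2 i j @^-1` B2 i j) `&` A0 @^-1` S)
    = \big[*%E/1%E]_(i < m1) \big[*%E/1%E]_(j < m2)
          (P (U1 i j @^-1` B1 i j) * P (U2 i j @^-1` B2 i j))
      * P (A0 @^-1` S).

End Prob.

Definition mm (m1 m2 p : nat) : nat := if p == 1%N then m1 else m2.

(* Main.v *)
Require Import Defs.
From HB Require Import structures.
From mathcomp Require Import all_boot all_order all_algebra.
From mathcomp Require Import all_classical all_reals all_analysis.
From mathcomp Require Import perm zify ring.
Import Order.TTheory GRing.Theory Num.Theory.

(** Almost surely the dynamic is driven by the two best-response maps and the
    initial profile, which are jointly uniform.  Uniformity is obtained by
    cutting the line into N + 1 consecutive cells of equal mass: the cells of
    all payoffs are then uniform on a finite set, every prescription of strict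
    best responses is realised by the same number of cell patterns (permute rows
    and columns), and patterns with a tie have proportion O(1/N).  Hence each
    prescription has probability at least (1 - O(1/N)) / (number of
    prescriptions), and since these events are exclusive, equality holds in the
    limit.

    For uniform maps, let z_0, z_1, ... be the successive actions.  The dynamic
    converges to a 2k-cycle iff for some s the actions z_0, ..., z_(s+2k-1) are
    distinct and z_(s+2k) = z_s.  As long as the actions are distinct, the
    response to the last one can be resampled freely, so it equals any given
    earlier action of the same player with probability 1/m; this gives both the
    product and the factor in front of it. *)

(** * Orbits and cycles *)

Section Orbit.
Context {V : eqType} (h : V -> V) (x : V).
Local Notation z := (fun n => iter n h x).

Lemma iter_eq_shift i j m : z i = z j -> z (i + m) = z (j + m).
Proof. by move=> /= e; rewrite ![(_ + m)%N]addnC !iterD e. Qed.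

Lemma iter_period s d q : z s = z (s + d) -> z s = z (s + q * d).
Proof.
move=> e; elim: q => [|q IH]; first by rewrite mul0n addn0.
by rewrite IH (iter_eq_shift _ _ (q * d) e) mulSn addnA.
Qed.

Lemma traject_uniqP n :
  reflect (forall i j, i < j -> j < n -> z i <> z j) (uniq (traject h x n)).
Proof.
apply: (iffP (uniqP x)) => [inj i j ij jn e|ne i j].
  have := inj i j; rewrite !inE size_traject !nth_traject //;
    last exact: ltn_trans jn.
  by move=> /(_ (ltn_trans ij jn) jn e) eij; rewrite eij ltnn in ij.
rewrite !inE size_traject => ltin ltjn; rewrite !nth_traject // => e.
case: (ltngtP i j) => // [/ne/(_ ltjn)//|/ne/(_ ltin) []].
by rewrite e.
Qed.

(* The least witness s of the left-hand side is the first point of the cycle. *)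
Lemma first_cycleP k : (0 < k)%N ->
    (forall i j, z i = z j -> odd i = odd j) ->
  (exists s, z s = z (s + 2 * k) /\
     forall k', 0 < k' -> k' < k -> z s <> z (s + 2 * k')) <->
  (exists s, uniq (traject h x (s + 2 * k)) /\ z (s + 2 * k) = z s).
Proof.
move=> k0 par; split; last first.
  move=> [s [/traject_uniqP u e]]; exists s; split=> // k' k'0 k'k.
  by apply: u; lia.
move=> ex.
have {ex} [s [[es ms] least]] : exists s,
    (z s = z (s + 2 * k) /\
     forall k', 0 < k' -> k' < k -> z s <> z (s + 2 * k')) /\
    (forall i, i < s -> ~ (z i = z (i + 2 * k) /\
     forall k', 0 < k' -> k' < k -> z i <> z (i + 2 * k'))).
  pose Q s := `[< z s = z (s + 2 * k) /\
     forall k', 0 < k' -> k' < k -> z s <> z (s + 2 * k') >].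
  have exQ : exists s, Q s by case: ex => s Hs; exists s; apply/asboolP.
  case: (ex_minnP exQ) => s /asboolP Qs min; exists s; split=> // i ltis Qi.
  by have /min : Q i by [apply/asboolP]; rewrite leqNgt ltis.
have toS i d : z i = z (i + d) -> z s = z (s + d).
  (* [i] may exceed [s], so the recurrence is pushed forward to [s + i * (2 * k)], which is at least
     [i] and is the same point as [s] by periodicity. *)
  move=> e.
  have e1 := iter_eq_shift _ _ (s + i * (2 * k) - i) e.
  have h1 : (i + (s + i * (2 * k) - i) = s + i * (2 * k))%N by nia.
  have h2 : (i + d + (s + i * (2 * k) - i) = s + i * (2 * k) + d)%N by nia.
  rewrite /= h1 h2 in e1; have e2 := iter_period s (2 * k) i es.
  have e3 := iter_eq_shift _ _ d e2.
  by rewrite /= in e2 e3 *; rewrite e2 e1 -e3.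
exists s; split; last by [].
apply/traject_uniqP => i j ltij ltj e.
have [d dE] : exists d, j = (i + d.*2)%N.
  have := par _ _ e => oij; exists ((j - i)./2).
  have : ~~ odd (j - i) by rewrite oddB 1?ltnW // oij addbb.
  by move=> /even_halfK ->; lia.
rewrite {}dE in ltij ltj e.
have sd := toS _ _ e.
(* A nonzero remainder would give a return time [2 * (d %% k)] forbidden by [ms]. *)
have kd : (d %% k = 0)%N.
  apply/eqP; rewrite -leqn0 leqNgt; apply/negP => m0.
  apply: (ms _ m0); first by rewrite ltn_mod.
  have e2 := iter_eq_shift _ _ (2 * (d %% k)) (iter_period s (2 * k) (d %/ k) es).
  rewrite [RHS]e2 [LHS]sd; congr (iter _ h x).
  by rewrite {1}(divn_eq d k) -addnA; lia.
case: (ltnP i s) => [ltis|leis]; last first.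
  by move: kd; rewrite modn_small; lia.
apply: (least i ltis); split; last first.
  by move=> k' k'0 k'k /toS; apply: ms.
(* The point [i] itself returns after [2 * k], against the minimality of [s]: going round its own
   loop [s] times leads past [s], where [2 * k] is a period. *)
have /(iter_eq_shift _ _ (2 * k)) e1 := iter_period i d.*2 s e.
have big : s <= i + s * d.*2 by nia.
have e2 := iter_eq_shift _ _ (i + s * d.*2 - s) es.
have h1 : (s + (i + s * d.*2 - s) = i + s * d.*2)%N by lia.
have h2 : (s + 2 * k + (i + s * d.*2 - s) = i + s * d.*2 + 2 * k)%N by lia.
rewrite /= h1 h2 in e2.
by rewrite (iter_period i d.*2 s e) [RHS]e1.
Qed.

End Orbit.

(** * Counting best-response maps *)

Lemma card_sum_pred {I : finType} (Q : pred I) : #|Q| = \sum_i Q i.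
Proof.
rewrite -sum1_card big_mkcond; apply: eq_bigr => i _.
by rewrite unfold_in; case: (Q i).
Qed.

Section BestResponseMaps.
Context {m1 m2 : nat}.

(* best-response maps of players 1 and 2 together with the initial profile *)
Definition response :=
  ({ffun 'I_m2 -> 'I_m1} * {ffun 'I_m1 -> 'I_m2} * ('I_m1 * 'I_m2))%type.
Local Notation V := ('I_m1 + 'I_m2)%type.
Implicit Types (r : response) (v w : V).

Definition step r v : V :=
  match v with inl x => inr (r.1.2 x) | inr y => inl (r.1.1 y) end.

(* [play r t] is the action chosen at time t (by player 2 at time 0). *)
Definition play r n : V := iter n (step r) (inr r.2.2).

Arguments play : simpl never.

Lemma playS r n : play r n.+1 = step r (play r n).
Proof. by []. Qed.

Definition is_player1 v : bool := if v is inl _ then true else false.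

(** Two actions of the same player prescribe no response; [r] is then kept. *)
Definition update r v w : response :=
  match v, w with
  | inl x, inr y => (r.1.1, [ffun x' => if x' == x then y else r.1.2 x'], r.2)
  | inr y, inl x => ([ffun y' => if y' == y then x else r.1.1 y'], r.1.2, r.2)
  | _, _ => r
  end.

Lemma is_player1_step r v : is_player1 (step r v) = ~~ is_player1 v.
Proof. by case: v. Qed.

Lemma is_player1_play r n : is_player1 (play r n) = odd n.
Proof. by elim: n => //= n IH; rewrite is_player1_step IH. Qed.

Lemma play_parity r i j : play r i = play r j -> odd i = odd j.
Proof. by rewrite -2!(is_player1_play r) => ->. Qed.

Lemma step_update r v w u : is_player1 w = ~~ is_player1 v ->
  step (update r v w) u = if u == v then w else step r u.
Proof.
case: v w u => [x|y] [x'|y'] [u|u] //= _; rewrite ?ffunE //.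
- by rewrite (_ : (inl u == inl x :> V) = (u == x)) //; case: ifP.
- by rewrite (_ : (inr u == inr y :> V) = (u == y)) //; case: ifP.
Qed.

Lemma update_start r v w : (update r v w).2 = r.2.
Proof. by case: v w => [x|y] [x'|y']. Qed.

Lemma step_inj r r' : r.2 = r'.2 -> step r =1 step r' -> r = r'.
Proof.
case: r r' => [[f g] a] [[f' g'] a'] /= -> e; congr (_, _, _); apply/ffunP => u.
  by have /= [] := e (inr u).
by have /= [] := e (inl u).
Qed.

Definition fresh n : pred response :=
  [pred r | uniq (traject (step r) (inr r.2.2) n.+1)].

(** For [j <= n], the first repetition of the orbit occurs at time [n.+1], so a map hits at most one
    such pair. *)
Definition hits n j : pred response :=
  [pred r | fresh n r && (play r n.+1 == play r j)].

Definition actions (b : bool) : nat := if b then m1 else m2.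

(** The first [n] moves consult only responses to actions chosen before time [n], all different from
    [play r n], so they do not see the change. *)
Lemma play_update r n w i : fresh n r -> is_player1 w = ~~ odd n -> i <= n ->
  play (update r (play r n) w) i = play r i.
Proof.
move=> /traject_uniqP u side; elim: i => [|i IH] lin.
  by rewrite /play /= update_start.
rewrite 2!playS IH 1?ltnW // step_update ?is_player1_play //.
case: eqP => // e; case: (u i n) => //.
Qed.

Lemma play_update_next r n w : fresh n r -> is_player1 w = ~~ odd n ->
  play (update r (play r n) w) n.+1 = w.
Proof.
move=> f side; rewrite playS play_update //.
by rewrite step_update ?eqxx ?is_player1_play.
Qed.

Lemma fresh_update r n w : fresh n r -> is_player1 w = ~~ odd n ->
  fresh n (update r (play r n) w).
Proof.
move=> f side; apply/traject_uniqP => i j ij jn.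
rewrite -!/(play _ _) !play_update //; last by rewrite -ltnS (ltn_trans ij).
by move/traject_uniqP : f; apply.
Qed.

Lemma card_is_player1 b : #|[pred v : V | is_player1 v == b]| = actions b.
Proof.
rewrite -sum1_card big_sumType /=.
by case: b; rewrite /= ?big_pred0_eq sum_nat_const card_ord muln1 ?addn0.
Qed.

(* Resampling the response to [play r n] is a bijection between pairs of a map
   in [hits n j] and an arbitrary response value, and [fresh n]. *)
Lemma card_hits n j : j <= n -> odd j = ~~ odd n ->
  (#|hits n j| * actions (~~ odd n) = #|fresh n|)%N.
Proof.
move=> jn par; rewrite -card_is_player1 -cardX.
pose F (p : response * V) := update p.1 (play p.1 n) p.2.
rewrite -(card_in_image (f := F)); last first.
  move=> [r v] [r' v'] /andP[/= /andP[fr /eqP hr] /eqP sv] /andP[/= /andP[fr' /eqP hr'] /eqP sv'].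
  rewrite /F /= => e.
  have ei i : i <= n -> play r i = play r' i.
    by move=> lin; rewrite -(play_update r n v i) // e play_update.
  have ev : v = v' by rewrite -(play_update_next r n v) // e play_update_next.
  congr (_, _) => //; apply: step_inj.
    by have := congr1 snd e; rewrite !update_start.
  move=> u; have := congr1 (fun q => step q u) e.
  rewrite /= !step_update ?is_player1_play // ei //.
  (* The overwritten response is not lost: it equals the action of time [j], which the update
     preserves. *)
  case: eqP => // -> _.
  rewrite -{1}(ei n) // -[LHS]/(play r n.+1) -[RHS]/(play r' n.+1) hr hr'.
  exact: ei.
apply: eq_card => r; apply/fintype.imageP/idP => [[[r' v]]|fr].
  by move=> /andP[/= /andP[fr _] /eqP sv] ->; apply: fresh_update.
have sj : is_player1 (play r j) = ~~ odd n by rewrite is_player1_play.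
(* Redirect the last response to the action of time [j], and keep the original response as second
   component. *)
exists (update r (play r n) (play r j), play r n.+1).
  rewrite !inE /= -/(fresh n _) fresh_update //= play_update_next //.
  by rewrite play_update // eqxx is_player1_play /= eqxx.
have sn : is_player1 (play r n.+1) = ~~ is_player1 (play r n).
  by rewrite !is_player1_play.
apply: step_inj; first by rewrite !update_start.
move=> u; rewrite /F /= play_update // !step_update ?is_player1_play //.
by case: eqP => // ->.
Qed.

Lemma freshS n r : fresh n.+1 r =
  (play r n.+1 \notin traject (step r) (inr r.2.2) n.+1) && fresh n r.
Proof.
by rewrite -[LHS]/(uniq (traject (step r) _ n.+2)) trajectSr rcons_uniq.
Qed.

(** The next action is new or repeats exactly one of the distinct earlier ones, at a time of the
    parity of [n.+1] since it belongs to the same player. *)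
Lemma fresh_split n r :
  (fresh n r = fresh n.+1 r + \sum_(j < n.+1 | odd j == ~~ odd n) hits n j r :> nat)%N.
Proof.
rewrite /hits /=; case fr: (fresh n r); last first.
  by rewrite big1 // addn0 freshS fr andbF.
rewrite freshS fr andbT.
case: trajectP => [[i lin e]|ne]; last first.
  rewrite /= big1 ?addn0 // => j _; case: eqP => // e.
  by case: ne; exists j => //; rewrite e.
have par : odd i == ~~ odd n by rewrite -(play_parity r n.+1 i e).
rewrite (bigD1 (Ordinal lin)) //= e eqxx big1 ?addn0 //.
move=> j /andP[_ ne]; case: eqP => //= e'; case/eqP: ne; apply/val_inj => /=.
move/traject_uniqP : fr => u; case: (ltngtP j i) => // [ji|ij].
  by case: (u j i).
by case: (u i j).
Qed.

(** The origin of the floor in the formula: the number of earlier actions of the player who moves at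
    time [n.+1]. *)
Lemma card_same_parity n : #|[pred j : 'I_n.+1 | odd j == ~~ odd n]| = n.+1./2.
Proof.
rewrite -sum1_card /=.
rewrite -(big_mkord (fun j => odd j == ~~ odd n) (fun=> 1%N)).
suff : forall b, \sum_(0 <= j < n.+1 | odd j == b) 1%N = if b then n.+1./2 else n.+2./2.
  by move=> -> /=; case: ifP => //= /negbFE o;
    rewrite uphalfE /= -[in LHS](odd_double_half n) -[in RHS](odd_double_half n) o; lia.
elim: n => [|n IH] b; first by rewrite big_mkcond big_nat1; case: b.
rewrite big_mkcond big_nat_recr //= -big_mkcond IH /=.
by case: b; case: (odd n) (odd_double_half n) => /=; lia.
Qed.

(** Division-free form of the factor [1 - (n.+1)./2 / m], with [m] the number of actions of the
    player moving at time [n.+1]. *)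
Lemma card_fresh_succ n :
  (#|fresh n| * actions (~~ odd n) =
   #|fresh n.+1| * actions (~~ odd n) + n.+1./2 * #|fresh n|)%N.
Proof.
have E : (#|fresh n| = #|fresh n.+1| + \sum_(j < n.+1 | odd j == ~~ odd n) #|hits n j|)%N.
  rewrite 2!card_sum_pred (eq_bigr (fun j : 'I_n.+1 => \sum_r hits n j r)%N);
    last by move=> j _; apply: card_sum_pred.
  rewrite exchange_big -big_split /=; apply: eq_bigr => r _; exact: fresh_split.
rewrite {1}E mulnDl; congr (_ + _)%N.
rewrite big_distrl /= (eq_bigr (fun=> #|fresh n|)); last first.
  by move=> j /eqP oj; apply: card_hits => //; rewrite -ltnS.
by rewrite sum_nat_const card_same_parity.
Qed.


Local Open Scope ring_scope.

Lemma mm_sc i : (0 < i)%N -> mm m1 m2 (sc i) = actions (odd i).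
Proof.
case: i => // i _; rewrite /mm /sc /actions subn1 /= modn2.
by case: (odd i).
Qed.

Hypotheses (m1_gt0 : (0 < m1)%N) (m2_gt0 : (0 < m2)%N).

Lemma actions_neq0 (K : numFieldType) b : (actions b)%:R != 0 :> K.
Proof. by rewrite pnatr_eq0 /actions; case: b; lia. Qed.

(** Iterates [card_fresh_succ] from the trivial case of a single action. The field stays general:
    [fresh_max] uses the rationals, the theorem the reals. *)
Lemma card_fresh (K : numFieldType) n : #|fresh n|%:R = #|{: response}|%:R *
  \prod_(1 <= i < n.+1) (1 - (mm m1 m2 (sc i))%:R^-1 * (i./2)%:R) :> K.
Proof.
elim: n => [|n IH]; first by rewrite big_geq // mulr1 eq_cardT.
rewrite big_nat_recr //= mulrA -IH mm_sc //=.
have /(congr1 (fun x => x%:R : K)) := card_fresh_succ n.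
rewrite natrD !natrM => e; have nz := actions_neq0 K (~~ odd n).
apply: (mulIf nz); rewrite -[LHS](addrK ((n.+1)./2%:R * #|fresh n|%:R)) -e.
by rewrite uphalfE; field.
Qed.

(** Pigeonhole, read off from the product: the factor at which a player has exhausted all actions
    vanishes. *)
Lemma fresh_max n r : (2 * minn m1 m2 < n)%N -> fresh n r = false.
Proof.
move=> lt; have [i [i0 ilt iE]] :
    exists i, [/\ (0 < i)%N, (i < n.+1)%N & i./2 = actions (odd i)].
  case: (leqP m1 m2) => le.
    (* Player 1 acts at odd times, so must repeat by [m1.*2.+1]; player 2 acts at even times
       starting with 0, so must repeat by [m2.*2]. *)
    exists (m1.*2).+1; split; [by []|lia|].
    by rewrite /actions /= odd_double uphalf_double.
  by exists m2.*2; split; [lia|lia|rewrite /actions odd_double doubleK].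
suff /card0_eq/(_ r) : #|fresh n| = 0%N by [].
apply/eqP; rewrite -(pnatr_eq0 rat) card_fresh (big_nat_widenl _ 0) //.
rewrite big_mkord (bigD1 (Ordinal ilt)) //= mm_sc // -iE.
by rewrite mulVf ?subrr ?mul0r ?mulr0 // iE actions_neq0.
Qed.

(** [s] is the time at which the orbit enters the cycle. By [fresh_max], [s + 2 * k - 1] is at most
    [2 * minn m1 m2], whence the range. *)
Definition converging k : pred response :=
  [pred r | [exists s : 'I_(2 * (minn m1 m2 - k + 1)), hits (s + 2 * k).-1 s r]].

Lemma convergingP k r : (0 < k <= minn m1 m2)%N ->
  (exists s, play r s = play r (s + 2 * k)%N /\
     forall k', (0 < k')%N -> (k' < k)%N -> play r s <> play r (s + 2 * k')%N) <->
  converging k r.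
Proof.
move=> /andP[k0 km].
have hitsE s : hits (s + 2 * k).-1 s r =
    uniq (traject (step r) (inr r.2.2) (s + 2 * k)) && (play r (s + 2 * k) == play r s).
  have e : ((s + 2 * k).-1.+1 = s + 2 * k)%N by lia.
  by rewrite -e.
split.
  move=> /(@first_cycleP _ _ _ _ k0 (play_parity r)) [s [u e]].
  have h : hits (s + 2 * k).-1 s r by rewrite hitsE u /=; apply/eqP.
  have ltsB : (s < 2 * (minn m1 m2 - k + 1))%N.
    rewrite ltnNge; apply/negP => le; move/andP : h => [+ _].
    by rewrite fresh_max //; lia.
  by apply/existsP; exists (Ordinal ltsB).
move=> /existsP[s]; rewrite hitsE => /andP[u /eqP e].
by apply/(@first_cycleP _ _ _ _ k0 (play_parity r)); exists s.
Qed.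

(** The first repetition determines [s], so the counts for different [s] add up; [card_hits] turns
    each into a fresh count divided by a number of actions. *)
Lemma card_converging (K : numFieldType) k : (0 < k <= minn m1 m2)%N ->
  #|converging k|%:R = #|{: response}|%:R *
    \sum_(1 <= t < (2 * (minn m1 m2 - k + 1)).+1)
       ((mm m1 m2 (sc (t + 2 * k - 1)))%:R^-1 *
        \prod_(1 <= i < (t + 2 * k - 2).+1)
          (1 - (mm m1 m2 (sc i))%:R^-1 * (i./2)%:R)) :> K.
Proof.
move=> /andP[k0 km]; set B := (2 * _)%N.
have -> : #|converging k| = (\sum_(s < B) #|hits (s + 2 * k).-1 s|)%N.
  rewrite card_sum_pred (eq_bigr (fun s : 'I_B => \sum_r hits (s + 2 * k).-1 s r)%N);
    last by move=> s _; apply: card_sum_pred.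
  rewrite exchange_big; apply: eq_bigr => r _.
  case: (boolP (converging k r)) => [/existsP[s hs]|/existsPn ne]; last first.
    by rewrite big1 // => s _; rewrite (negbTE (ne s)).
  rewrite (bigD1 s) // hs big1 // => s' /andP[_ ne].
  case: (boolP (hits _ _ _)) => // hs'; case/eqP: ne; apply/val_inj => /=.
  have cross i j : (i < j)%N -> hits (i + 2 * k).-1 i r -> hits (j + 2 * k).-1 j r -> False.
    move=> ij /andP[_ /eqP e] /andP[/traject_uniqP u _].
    by apply: (u i (i + 2 * k).-1.+1 _ _ (esym e)); lia.
  case: (ltngtP s' s) => // lt; case: (cross _ _ lt) => //.
(* The summation index of the formula is [t = s.+1]. *)
rewrite natr_sum mulr_sumr big_add1 /= big_mkord; apply: eq_bigr => s _.
have e1 : (s.+1 + 2 * k - 1 = (s + 2 * k).-1.+1)%N by lia.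
have e2 : (s.+1 + 2 * k - 2 = (s + 2 * k).-1)%N by lia.
rewrite e1 e2 mulrCA -card_fresh mm_sc //.
rewrite -(card_hits (s + 2 * k).-1 s) ?natrM; [|lia|lia].
by rewrite /= mulrCA mulVf ?mulr1 // actions_neq0.
Qed.

End BestResponseMaps.

Arguments play : simpl never.

(** * Cell patterns without ties *)

Section Ties.
Context {J : finType} (N : nat).
Implicit Type g : {ffun J -> 'I_N.+1}.

(** Resampling the value at [p] of a tied pattern is injective, as the old value can still be read
    at [q]. *)
Lemma card_tie (p q : J) : p != q ->
  #|[pred g : {ffun J -> 'I_N.+1} | g p == g q]| * N.+1 <= #|{ffun J -> 'I_N.+1}|.
Proof.
move=> pq; rewrite -[X in _ * X]card_ord -cardX.
pose F (u : {ffun J -> 'I_N.+1} * 'I_N.+1) :=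
  [ffun i => if i == p then u.2 else u.1 i].
rewrite -(card_in_image (f := F)) ?max_card //.
move=> [g i] [g' i'] /andP[/= /eqP gpq _] /andP[/= /eqP gpq' _] /ffunP e.
have := e p; rewrite !ffunE eqxx /= => ->; congr (_, _).
have off j : j != p -> g j = g' j.
  by move=> jp; have := e j; rewrite !ffunE (negbTE jp).
apply/ffunP => j; have [->|] := eqVneq j p; last exact: off.
by rewrite gpq gpq' off // eq_sym.
Qed.

(** Union bound over pairs of indices. *)
Lemma card_not_injective :
  #|[pred g : {ffun J -> 'I_N.+1} | ~~ injectiveb g]| * N.+1 <=
  #|J| * #|J| * #|{ffun J -> 'I_N.+1}|.
Proof.
pose tie (u : J * J) := [pred g : {ffun J -> 'I_N.+1} | g u.1 == g u.2].
have le : #|[pred g : {ffun J -> 'I_N.+1} | ~~ injectiveb g]| <=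
    \sum_(u : J * J | u.1 != u.2) #|tie u|.
  rewrite -sum1_card;
    under [X in _ <= X]eq_bigr do rewrite -sum1_card big_mkcond /=.
  rewrite exchange_big /= big_mkcond /=; apply: leq_sum => g _; case: ifP => //.
  move=> /injectivePn[p [q pq e]]; rewrite (bigD1 (p, q)) //= inE /= e eqxx.
  exact: leq_addr.
apply: leq_trans (leq_mul le (leqnn _)) _; rewrite big_distrl /= -cardX.
rewrite -sum_nat_const (@leq_trans (\sum_(u : J * J | u.1 != u.2) #|{ffun J -> 'I_N.+1}|)) //.
  by apply: leq_sum => u ne; apply: card_tie.
rewrite [X in X <= _]big_mkcond [X in _ <= X]big_mkcond /=.
by apply: leq_sum => u _; case: ifP.
Qed.

End Ties.

(** * Strict best responses in cell patterns *)

Section StrictPatterns.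
Context {m1 m2 : nat} (N : nat).
Hypotheses (m1_gt0 : 0 < m1) (m2_gt0 : 0 < m2).

(* [(true, (x, y))] and [(false, (x, y))] index the payoffs of players 1 and 2 *)
Local Notation J := (bool * ('I_m1 * 'I_m2))%type.
Local Notation FG := ({ffun 'I_m2 -> 'I_m1} * {ffun 'I_m1 -> 'I_m2})%type.
Local Notation pattern := {ffun J -> 'I_N.+1}.

Definition dominates (u : FG) : pred pattern := [pred g : pattern |
  [forall x, forall y,
     ((x != u.1 y) ==> (g (true, (x, y)) < g (true, (u.1 y, y)))) &&
     ((y != u.2 x) ==> (g (false, (x, y)) < g (false, (x, u.2 x))))]].

Lemma dominatesP (u : FG) (g : pattern) : reflect
  ((forall x y, x != u.1 y -> g (true, (x, y)) < g (true, (u.1 y, y))) /\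
   (forall x y, y != u.2 x -> g (false, (x, y)) < g (false, (x, u.2 x))))
  (dominates u g).
Proof.
apply: (iffP forallP) => [H|[H1 H2] x].
  by split=> x y ne; have /forallP/(_ y)/andP[/implyP h1 /implyP h2] := H x; auto.
by apply/forallP => y; apply/andP; split; apply/implyP; auto.
Qed.

(* Transposing the two prescribed best responses in every row and column maps
   the patterns of [u] into those of [v]. *)
Lemma leq_card_dominates (u v : FG) : #|dominates u| <= #|dominates v|.
Proof.
pose sw (i : J) : J := let: (b, (x, y)) := i in
  if b then (b, (tperm (u.1 y) (v.1 y) x, y))
  else (b, (x, tperm (u.2 x) (v.2 x) y)).
have swK : involutive sw by move=> [[] [x y]] /=; rewrite tpermK.
pose F (g : pattern) : pattern := [ffun i => g (sw i)].
have Finj : injective F.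
  by move=> g g' /ffunP e; apply/ffunP => i; have := e (sw i); rewrite !ffunE swK.
rewrite -(fintype.card_image Finj); apply: subset_leq_card.
apply/fintype.subsetP => _ /fintype.imageP[g /dominatesP[H1 H2] ->].
apply/dominatesP; split=> x y ne; rewrite !ffunE /= tpermR.
  by apply: H1;
    rewrite -(inj_eq (@perm_inj _ (tperm (u.1 y) (v.1 y)))) tpermK tpermL.
by apply: H2; rewrite -(inj_eq (@perm_inj _ (tperm (u.2 x) (v.2 x)))) tpermK tpermL.
Qed.

Lemma injective_dominates (g : pattern) : injective g -> exists u, dominates u g.
Proof.
move=> inj; pose x0 := Ordinal m1_gt0; pose y0 := Ordinal m2_gt0.
pose f := [ffun y => [arg max_(x > x0) (g (true, (x, y)) : nat)]].
pose h := [ffun x => [arg max_(y > y0) (g (false, (x, y)) : nat)]].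
exists (f, h); apply/dominatesP; split=> x y /=; rewrite ffunE.
  case: arg_maxnP => // x' _ max; rewrite ltn_neqAle [X in _ && X]max // andbT.
  by apply: contra => /eqP/val_inj/inj [->].
case: arg_maxnP => // y' _ max; rewrite ltn_neqAle [X in _ && X]max // andbT.
by apply: contra => /eqP/val_inj/inj [->].
Qed.

(** Every injective pattern lies in some [dominates v], none of which is larger than [dominates u];
    the last term pays for the patterns with ties. *)
Lemma card_dominates (u : FG) :
  #|{: pattern}| * N.+1 <= #|{: FG}| * #|dominates u| * N.+1 +
                           #|{: J}| * #|{: J}| * #|{: pattern}|.
Proof.
have inj_le : #|[pred g : pattern | injectiveb g]| <= #|{: FG}| * #|dominates u|.
  rewrite -sum_nat_const; apply: (@leq_trans (\sum_(v : FG) #|dominates v|));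
    last first.
    by apply: leq_sum => v _; apply: leq_card_dominates.
  rewrite -sum1_card;
    under [X in _ <= X]eq_bigr do rewrite -sum1_card big_mkcond /=.
  rewrite exchange_big /= big_mkcond /=; apply: leq_sum => g _; rewrite inE;
    case: ifP => //.
  move=> /injectiveP /injective_dominates [v dv]; rewrite (bigD1 v) //=.
  by rewrite (_ : (g \in _) = true) ?leq_addr.
apply: leq_trans (leq_add (leq_mul inj_le (leqnn N.+1)) (card_not_injective N)).
by rewrite -mulnDl -(cardC [pred g : pattern | injectiveb g]).
Qed.

End StrictPatterns.

Local Open Scope classical_set_scope.
Local Open Scope ring_scope.

(** * Quantiles of an atomless law *)

Section Quantiles.
Context {R : realType} (mu : probability R R).
Hypothesis atomless : forall x : R, mu [set x] = 0%E.

Let le_cdf (x y : R) : x <= y -> (mu `]-oo, x]%classic <= mu `]-oo, y]%classic)%E.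
Proof.
by move=> xy; apply: le_measure; rewrite ?inE //; apply: subset_itvl;
  rewrite bnd_simp.
Qed.

(** The quantile is the supremum of [S]; continuity of the measure along monotone sequences of rays
    gives both inequalities. *)
Lemma atomless_quantile (c : R) : 0 < c < 1 ->
  exists t : R, mu `]-oo, t]%classic = c%:E.
Proof.
move=> /andP[c0 c1].
pose S := [set u : R | (mu `]-oo, u]%classic <= c%:E)%E].
have below (F : (set R)^nat) : (forall n, measurable (F n)) ->
    nondecreasing_seq F -> (forall n, (mu (F n) <= c%:E)%E) ->
    (mu (\bigcup_n F n) <= c%:E)%E.
  move=> mF ndF Fc.
  have cvgF := nondecreasing_cvg_mu (mu := mu) mF (bigcup_measurable (fun n _ => mF n)) ndF.
  by rewrite -(cvg_lim _ cvgF) //; apply: lime_le;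
    [apply/cvg_ex; eexists; exact: cvgF|apply: nearW].
have above (F : (set R)^nat) : (forall n, measurable (F n)) ->
    nonincreasing_seq F -> (forall n, (c%:E <= mu (F n))%E) ->
    (c%:E <= mu (\bigcap_n F n))%E.
  move=> mF niF Fc.
  have mF0 : (mu (F 0%N) < +oo)%E by apply: (le_lt_trans (probability_le1 _ (mF 0%N))); rewrite ltry.
  have cvgF := nonincreasing_cvg_mu (mu := mu) mF0 mF (bigcap_measurable (ex_intro _ 0%N I) (fun n _ => mF n)) niF.
  by rewrite -(cvg_lim _ cvgF) //; apply: lime_ge;
    [apply/cvg_ex; eexists; exact: cvgF|apply: nearW].
(* An empty [S] would leave mass at least [c] in all rays ending at [- n%:R], whose intersection is
   empty. *)
have S0 : S !=set0.
  apply/set0P/negP => /eqP S0.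
  have := above (fun n => `]-oo, (- n%:R : R)]%classic).
  rewrite (_ : \bigcap_n _ = set0) ?measure0.
    rewrite leNgt lte_fin c0 /= => H; suff : false by []; apply: H => // [n p np|n].
      by apply/subsetPset; apply: subset_itvl; rewrite bnd_simp lerN2 ler_nat.
    rewrite leNgt; apply/negP => /ltW Sn.
    by have : set0 (- n%:R : R) by rewrite -S0.
  rewrite -subset0 => u /(_ (Num.truncn `|u|).+1 I) /=;
    rewrite in_itv /= lerNr leNgt.
  by rewrite (le_lt_trans _ (truncnS_gt _)) // -normrN ler_norm.
have Sub u v : S u -> (c%:E < mu `]-oo, v]%classic)%E -> u < v.
  by move=> Su cv; rewrite ltNge; apply/negP => /le_cdf /(lt_le_trans cv);
    rewrite ltNge Su.
have [b cb] : exists b, (c%:E < mu `]-oo, b]%classic)%E.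
  apply/not_existsP => nb.
  have := below (fun n => `]-oo, (n%:R : R)]%classic).
  rewrite (_ : \bigcup_n _ = setT) ?probability_setT.
    rewrite leNgt lte_fin c1 /= => H; suff : false by []; apply: H => // [n p np|n].
      by apply/subsetPset; apply: subset_itvl; rewrite bnd_simp ler_nat.
    by rewrite leNgt; apply/negP/nb.
  rewrite -subTset => u _; exists (Num.truncn `|u|).+1 => //=.
  by rewrite in_itv /= (le_trans (ler_norm u)) // ltW // truncnS_gt.
have supS : has_sup S by split=> //; exists b => u Su; apply/ltW/Sub.
exists (sup S); apply/eqP; rewrite eq_le; apply/andP; split.
  (* The end point has no mass, and the open ray is exhausted by rays ending strictly below the
     supremum, of mass at most [c]. *)
  have -> : `]-oo, sup S]%classic = `]-oo, sup S[%classic `|` [set sup S] by rewrite setUitv1.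
  rewrite measureU //; last first.
    by rewrite -subset0 => u [/=]; rewrite in_itv /= => lt e; move: lt;
      rewrite e ltxx.
  rewrite [X in (_ + X)%E]atomless adde0.
  have := below (fun n => `]-oo, (sup S - n.+1%:R^-1)]%classic).
  rewrite (_ : \bigcup_n _ = `]-oo, sup S[%classic).
    apply => // [n p np|n].
      by apply/subsetPset; apply: subset_itvl;
        rewrite bnd_simp lerB // lef_pV2 ?posrE // ler_nat.
    have n0 : 0 < n.+1%:R^-1 :> R by [].
    have [u Su lt] := sup_adherent n0 supS.
    by apply: le_trans Su; apply/le_cdf/ltW.
  apply/seteqP; split=> u /=.
    by move=> [n _ /=]; rewrite !in_itv /= => /le_lt_trans; apply;
      rewrite ltrBlDr ltrDl.
  rewrite in_itv /= -subr_gt0 => lt; exists (Num.truncn (sup S - u)^-1) => //=.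
  rewrite in_itv /= lerBrDr -lerBrDl -[leRHS]invrK lef_pV2 ?posrE ?invr_gt0 //.
  by rewrite ltW // truncnS_gt.
(* For the lower bound, the points [sup S + n.+1%:R^-1] lie outside [S]. *)
have := above (fun n => `]-oo, (sup S + n.+1%:R^-1)]%classic).
rewrite (_ : \bigcap_n _ = `]-oo, sup S]%classic).
  apply => // [n p np|n].
    by apply/subsetPset; apply: subset_itvl;
      rewrite bnd_simp lerD // lef_pV2 ?posrE // ler_nat.
  rewrite leNgt; apply/negP => /ltW Sn.
  have := ub_le_sup (proj2 supS) Sn.
  by rewrite gerDl leNgt invr_gt0 ltr0n.
apply/seteqP; split=> u /=; last first.
  by rewrite in_itv /= => le n _ /=; rewrite in_itv /= (le_trans le) // lerDl.
move=> H; rewrite in_itv /=; apply/ler_addgt0Pr => e e0.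
have := H (Num.truncn e^-1) I; rewrite /= in_itv /= => /le_trans; apply.
by rewrite lerD2l -[leRHS]invrK lef_pV2 ?posrE ?invr_gt0 // ltW // truncnS_gt.
Qed.

(** Cut at the [N] quantiles of level [i.+1 / N.+1]; the cell of a point is the number of cut points
    strictly below it. *)
Lemma quantile_cells N : exists c : R -> 'I_N.+1,
  [/\ forall j, measurable (c @^-1` [set j]),
      forall j, mu (c @^-1` [set j]) = (N.+1%:R^-1)%:E
    & forall u v, (c u < c v)%N -> u < v].
Proof.
have /choice[t tE] : forall i : 'I_N, exists t : R,
    mu `]-oo, t]%classic = (i.+1%:R / N.+1%:R)%:E.
  move=> i; apply: atomless_quantile; rewrite divr_gt0 // ltr_pdivrMr // mul1r.
  by rewrite /= ltr_nat ltnS ltn_ord.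
have t_lt (i j : 'I_N) : (i < j)%N -> t i < t j.
  move=> ij; rewrite ltNge; apply/negP => /le_cdf; rewrite !tE lee_fin.
  by rewrite ler_pM2r ?invr_gt0 // ler_nat ltnS leqNgt ij.
pose n u := #|[pred i | t i < u]|.
have nN u : (n u < N.+1)%N.
  by rewrite ltnS (leq_trans (max_card _)) // card_ord.
have n_le u v : u <= v -> (n u <= n v)%N.
  move=> uv; apply: subset_leq_card; apply/fintype.subsetP => i; rewrite !inE => tu.
  exact: lt_le_trans uv.
have nE u (j : 'I_N) : (n u < j.+1)%N = (u <= t j).
  apply/idP/idP => [|le].
    apply: contraTT; rewrite -ltNge -leqNgt => lt.
    have <- : #|[pred i : 'I_N | (i < j.+1)%N]| = j.+1.
      rewrite -[RHS]card_ord.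
      rewrite -(fintype.card_image (f := widen_ord (ltn_ord j))) ;
        last by move=> x y [/val_inj].
      apply: eq_card => i; rewrite inE; apply/idP/fintype.imageP => [ij|[x _ ->]];
        last exact: ltn_ord x.
      by exists (Ordinal ij) => //; apply/val_inj.
             apply: subset_leq_card; apply/fintype.subsetP => i;
               rewrite !inE ltnS leq_eqVlt.
    by case/orP => [/eqP/val_inj -> //|/t_lt /lt_trans]; apply.
  rewrite ltnS -[leqRHS](card_ord j).
  rewrite -(fintype.card_image (f := widen_ord (ltnW (ltn_ord j)))) ;
    last by move=> x y [/val_inj].
  apply: subset_leq_card; apply/fintype.subsetP => i; rewrite !inE => tu.
  apply/fintype.imageP.
  have ij : (i < j)%N.
    rewrite ltnNge leq_eqVlt; apply/negP => /orP[/eqP/val_inj e|/t_lt lt].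
      by move: tu; rewrite -e ltNge le.
    by have := lt_trans lt (lt_le_trans tu le); rewrite ltxx.
  by exists (Ordinal ij) => //; apply/val_inj.
(* [L j] gathers the cells below [j]: a ray ending at a cut point, except that [L 0] is empty and
   [L N.+1] is the whole line. *)
pose L j := [set u | (n u < j)%N].
have [mL muL] : (forall j, (j <= N.+1)%N -> measurable (L j)) /\
    (forall j, (j <= N.+1)%N -> mu (L j) = (j%:R / N.+1%:R)%:E).
  suff H j : (j <= N.+1)%N -> measurable (L j) /\ mu (L j) = (j%:R / N.+1%:R)%:E.
    by split=> j /H[].
  case: j => [|j] jN.
    have -> : L 0%N = set0 by rewrite -subset0.
    by rewrite measure0 mul0r.
  have [lt|ge] := ltnP j N.
    have -> : L j.+1 = `]-oo, t (Ordinal lt)]%classic.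
      by apply/seteqP; split=> u; rewrite /L /= in_itv /= -nE.
    by rewrite tE.
  have -> : L j.+1 = setT by rewrite -subTset => u _;
    rewrite /L /= (leq_trans (nN u)).
  have -> : j.+1 = N.+1 by lia.
  by rewrite probability_setT divff.
pose c u : 'I_N.+1 := Ordinal (nN u).
have cE (j : 'I_N.+1) : c @^-1` [set j] = L j.+1 `\` L j.
  apply/seteqP; split=> u /=; rewrite /L /=.
    by move=> <- /=; split; [rewrite ltnS|rewrite ltnn].
  by case=> h1 h2; apply/val_inj => /=; lia.
exists c; split=> [j|j|u v].
- by rewrite cE; apply: measurableD; apply: mL => //; apply: ltnW.
- have mj1 := mL _ (ltn_ord j); have mj := mL _ (ltnW (ltn_ord j)).
  have fin : (mu (L j.+1) < +oo)%E by rewrite muL ?ltry.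
  rewrite cE (measureD mj1 mj fin) setIidr; last by move=> u; apply: leqW.
  rewrite [X in (X - _)%E](muL j.+1) // [X in (_ - X)%E](muL j); last exact: ltnW.
  by rewrite -EFinB -mulrBl -natrB // subSnn mul1r.
- by rewrite /= ltNge => lt; apply/negP => /n_le; rewrite leqNgt lt.
Qed.

End Quantiles.

(** * The clockwork dynamic *)

(** The arg max, tie-breaking included, depends on the comparisons alone; this gives measurability
    even where ties occur. *)
Lemma eq_extremum {T T' : eqType} {I : finType} (o : rel T) (o' : rel T')
    (i0 : I) (Q : pred I) (F : I -> T) (F' : I -> T') :
  (forall i j, o (F i) (F j) = o' (F' i) (F' j)) ->
  extremum o i0 Q F = extremum o' i0 Q F'.
Proof.
move=> e; rewrite /extremum; congr odflt; apply: eq_pick => i /=.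
by congr (_ && _); apply: eq_forallb => j; rewrite e.
Qed.

Section Dynamics.
Context {R : realType} {m1 m2 : nat}.
Implicit Types (pay : 'I_m1 -> 'I_m2 -> R) (r : @response m1 m2).

Lemma eq_clockwork pay1 pay2 pay1' pay2' a t :
    (forall x x' y, (pay1 x y <= pay1 x' y) = (pay1' x y <= pay1' x' y)) ->
    (forall x y y', (pay2 x y <= pay2 x y') = (pay2' x y <= pay2' x y')) ->
  clockwork pay1 pay2 a t = clockwork pay1' pay2' a t.
Proof.
move=> e1 e2; elim: t => //= t ->; case: ifP => _; congr (_, _).
  by apply: eq_extremum => x x'; apply: e1.
by apply: eq_extremum => y y'; apply: e2.
Qed.

Definition strict_responses pay1 pay2 r :=
  (forall x y, x != r.1.1 y -> pay1 x y < pay1 (r.1.1 y) y) /\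
  (forall x y, y != r.1.2 x -> pay2 x y < pay2 x (r.1.2 x)).

Lemma arg_max_strict {I : finType} (F : I -> R) (i0 i : I) :
  (forall j, j != i -> F j < F i) -> [arg max_(j > i0) F j]%O = i.
Proof.
move=> lt; case: arg_maxP => // j _ max; apply/eqP; apply: contraT => /lt.
by rewrite ltNge => /negP; case; apply: max.
Qed.

Section Strict.
Variables (pay1 pay2 : 'I_m1 -> 'I_m2 -> R) (r : @response m1 m2).
Hypothesis strict : strict_responses pay1 pay2 r.
Local Notation A := (clockwork pay1 pay2 r.2).

Lemma clockworkS t : A t.+1 =
  if odd t then ((A t).1, r.1.2 (A t).1) else (r.1.1 (A t).2, (A t).2).
Proof.
rewrite /= /sc subn1 modn2 /=; case: (odd t) => /=.
  by rewrite /br2 (@arg_max_strict _ _ _ (r.1.2 (A t).1)) //; apply: strict.2.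
by rewrite /br1 (@arg_max_strict _ _ _ (r.1.1 (A t).2)) // => x; apply: strict.1.
Qed.

(** A profile consists of the last two actions of the orbit. The first move replaces the initial
    action of player 1, so [play] starts from that of player 2. *)
Lemma clockwork_play t : if odd t
  then play r t.+1 = inr (A t.+1).2 /\ play r t = inl (A t.+1).1
  else play r t.+1 = inl (A t.+1).1 /\ play r t = inr (A t.+1).2.
Proof.
elim: t => [|t IH]; first by rewrite clockworkS.
move: IH; rewrite (clockworkS t.+1) [odd t.+1]/=.
by case: (odd t) => /= -[e1 e2]; rewrite playS e1.
Qed.

(** Profile time [s.+1] matches orbit time [s]. An even shift keeps the mover, and equal actions
    have equal successors, so one action settles the whole profile. *)
Lemma clockwork_eq s j :
  A s.+1 = A (s.+1 + 2 * j)%N <-> play r s = play r (s + 2 * j)%N.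
Proof.
have o : odd (s + 2 * j) = odd s by rewrite oddD mul2n odd_double addbF.
have H := clockwork_play s; have := clockwork_play (s + 2 * j).
rewrite o addSn => H0; split=> e.
  by move: H0 H; rewrite -e; case: (odd s) => -[_ ->] [_ ->].
have e' : play r s.+1 = play r (s + 2 * j).+1 by rewrite 2!playS e.
rewrite [LHS]surjective_pairing [RHS]surjective_pairing; move: H0 H.
by case: (odd s) => -[h1 h2] [h3 h4]; congr (_, _);
  [move: e|move: e'|move: e'|move: e]; rewrite ?h1 ?h2 ?h3 ?h4 => -[].
Qed.

Lemma converges_to_cycleP k : (0 < k <= minn m1 m2)%N ->
  converges_to_cycle A k <-> converging k r.
Proof.
move=> kP; have [k0 _] := andP kP;
  have [m1_gt0 m2_gt0] : (0 < m1)%N /\ (0 < m2)%N by lia.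
rewrite -(convergingP m1_gt0 m2_gt0) //.
split=> [[[|s] []//= _ e ne]|[s [e ne]]].
  exists s; split; first exact/clockwork_eq.
  by move=> k' k'0 k'k /clockwork_eq; apply: ne => //; lia.
exists s.+1; split=> //; first exact/clockwork_eq.
by move=> k' k'0 k'k /clockwork_eq; apply: ne => //; lia.
Qed.

End Strict.
End Dynamics.

(** * Random games *)

Lemma in_bigsetI {T I : Type} (s : seq I) (Q : pred I) (F : I -> set T) w :
  (forall i, Q i -> F i w) -> (\big[setI/setT]_(i <- s | Q i) F i) w.
Proof. by move=> H; elim/big_rec: _ => // i A Qi Aw; split=> //; apply: H. Qed.

Lemma bigsetI_ordP {T : Type} {n : nat} (F : 'I_n -> set T) w :
  (\big[setI/setT]_(i < n) F i) w <-> forall i, F i w.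
Proof.
split=> [H i|H]; last by apply: in_bigsetI => i _.
by move: H; rewrite (bigD1 i) //= => -[].
Qed.

(** * Finite families of exclusive events *)

Section FiniteMeasure.
Context {d : measure_display} {T : measurableType d} {R : realType}.
Variable P : probability T R.
Context {I : finType}.
Implicit Types (Q : pred I) (F : I -> set T).

Definition exclusive F := forall i j w, F i w -> F j w -> i = j.

Lemma probability_bigsetU Q F : (forall i, measurable (F i)) -> exclusive F ->
  P (\big[setU/set0]_(i | Q i) F i) = (\sum_(i | Q i) P (F i))%E.
Proof.
move=> mF ex; elim: (index_enum I) (index_enum_uniq I) => [|i s IH].
  by rewrite !big_nil measure0.
move=> /andP[nis us]; rewrite !big_cons; case: ifP => Qi; last exact: IH.
rewrite measureU //; [by congr (_ + _)%E; apply: IH | exact: bigsetU_measurable |].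
rewrite -subset0 => w [Fi]; rewrite -bigcup_seq_cond => -[j /= /andP[js _]] Fj.
by rewrite (ex _ _ _ Fi Fj) js in nis.
Qed.

Lemma sum_probability_le Q F (A : set T) : (forall i, measurable (F i)) ->
  exclusive F -> measurable A -> (forall i, Q i -> F i `<=` A) ->
  (\sum_(i | Q i) P (F i) <= P A)%E.
Proof.
move=> mF ex mA sub; rewrite -probability_bigsetU //.
apply: le_measure; rewrite ?inE //; first exact: bigsetU_measurable.
by rewrite -bigcup_seq_cond => w [i /= /andP[_ Qi]]; apply: sub.
Qed.

(** [A] is the finite union of the fibres of [X] that it meets. *)
Lemma measurable_determined (X : T -> I) (A : set T) :
  (forall i, measurable (X @^-1` [set i])) ->
  (forall w w', X w = X w' -> A w -> A w') -> measurable A.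
Proof.
move=> mX det.
have -> : A = \big[setU/set0]_(i | `[< exists w, X w = i /\ A w >]) X @^-1` [set i].
  apply/seteqP; split=> w.
    move=> Aw; rewrite -bigcup_seq_cond; exists (X w) => //=.
    by rewrite mem_index_enum; apply/asboolP; exists w.
  rewrite -bigcup_seq_cond => -[i /= /andP[_ /asboolP[w' [e Aw']]] e'].
  by apply: det Aw'; rewrite e e'.
exact: bigsetU_measurable.
Qed.

(* Lower bounds on exclusive events suffice, by applying them to [A] and to
   its complement. *)
Lemma probability_uniform (E : I -> set T) Q (A : set T) :
    (0 < #|I|)%N -> (forall i, measurable (E i)) -> exclusive E ->
    (forall i, ((#|I|%:R^-1)%:E <= P (E i))%E) ->
    measurable A -> (forall i, Q i -> E i `<=` A) ->
    (forall i, ~~ Q i -> E i `<=` ~` A) ->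
  P A = (#|Q|%:R / #|I|%:R)%:E.
Proof.
move=> I0 mE ex lb mA inA outA.
have lb_sum (Q' : pred I) (B : set T) : measurable B ->
    (forall i, Q' i -> E i `<=` B) -> ((#|Q'|%:R / #|I|%:R)%:E <= P B)%E.
  move=> mB sub; apply: le_trans (sum_probability_le Q' E B mE ex mB sub).
  apply: (@le_trans _ _ (\sum_(i | Q' i) (#|I|%:R^-1)%:E)%E); last exact: lee_sum.
  by rewrite sumEFin sumr_const mulr_natl.
apply/eqP; rewrite eq_le lb_sum // andbT.
have := lb_sum (predC Q) (~` A) (measurableC mA) outA.
rewrite probability_setC // -[P A]fineK ?fin_num_measure // -EFinB !lee_fin.
have cQ : #|predC Q| = (#|I| - #|Q|)%N by rewrite -(cardC Q) addKn.
rewrite cQ natrB ?max_card // mulrBl divff ?pnatr_eq0 -?lt0n //.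
by rewrite lerD2l lerN2.
Qed.

End FiniteMeasure.

(** * Uniformity of the random best-response maps *)

Section RandomGame.
Context {d : measure_display} {T : measurableType d} {R : realType}.
Variables (P : probability T R) (m1 m2 : nat).
Variables (U1 U2 : 'I_m1 -> 'I_m2 -> T -> R) (A0 : T -> ('I_m1 * 'I_m2)%type).
Variable mu : probability R R.
Hypotheses (m1_gt0 : (0 < m1)%N) (m2_gt0 : (0 < m2)%N).
Hypothesis mU1 : forall i j, measurable_fun setT (U1 i j).
Hypothesis mU2 : forall i j, measurable_fun setT (U2 i j).
Hypothesis mA0 : forall S : set ('I_m1 * 'I_m2), measurable (A0 @^-1` S).
Hypothesis atomless : forall x : R, mu [set x] = 0%E.
Hypothesis lawU1 :
  forall i j (B : set R), measurable B -> P (U1 i j @^-1` B) = mu B.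
Hypothesis lawU2 :
  forall i j (B : set R), measurable B -> P (U2 i j @^-1` B) = mu B.
Hypothesis lawA0 : forall a, P (A0 @^-1` [set a]) = ((m1 * m2)%:R^-1)%:E.
Hypothesis indep : game_independent P U1 U2 A0.

Local Notation J := (bool * ('I_m1 * 'I_m2))%type.
Local Notation response := (@response m1 m2).

Definition payoff (i : J) : T -> R :=
  if i.1 then U1 i.2.1 i.2.2 else U2 i.2.1 i.2.2.

(** A finite-valued variable that determines both the dynamic and the events [responds], through
    which their measurability is proved. *)
Definition comparisons (w : T) : {ffun J * J -> bool} * ('I_m1 * 'I_m2) :=
  ([ffun u => payoff u.1 w <= payoff u.2 w], A0 w).

Lemma measurable_payoff i : measurable_fun setT (payoff i).
Proof. by rewrite /payoff; case: i.1. Qed.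

Lemma measurable_comparisons v : measurable (comparisons @^-1` [set v]).
Proof.
have -> : comparisons @^-1` [set v] =
    \big[setI/setT]_(u : J * J) [set w | (payoff u.1 w <= payoff u.2 w) = v.1 u]
    `&` A0 @^-1` [set v.2].
  apply/seteqP; split=> w /=.
    move=> <-; split=> //; apply: in_bigsetI => u _ /=; by rewrite ffunE.
  move=> [H e]; rewrite [RHS]surjective_pairing -e; congr (_, _).
  apply/ffunP => u; rewrite ffunE.
  by move: H; rewrite (bigD1 u) //= => -[].
apply: measurableI; last exact: mA0.
apply: bigsetI_measurable => u _.
have mle := measurable_realfun.measurable_fun_ler (measurable_payoff u.1) (measurable_payoff u.2).
by have := mle measurableT [set v.1 u]; rewrite setTI; apply.
Qed.

Lemma eq_comparisons w w' i j : comparisons w = comparisons w' ->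
  (payoff i w <= payoff j w) = (payoff i w' <= payoff j w').
Proof. by move=> [/ffunP/(_ (i, j)) + _]; rewrite !ffunE. Qed.

Definition responds (r : response) : set T :=
  [set w | strict_responses (fun x y => U1 x y w) (fun x y => U2 x y w) r /\ A0 w = r.2].

Lemma measurable_responds r : measurable (responds r).
Proof.
apply: (measurable_determined comparisons _ measurable_comparisons) => w w' e [[H1 H2] a].
split; last by rewrite -a; case: e.
split=> x y ne.
  have := H1 x y ne; rewrite !ltNge; apply: contra.
  by have -> := eq_comparisons _ _ (true, (r.1.1 y, y)) (true, (x, y)) e.
have := H2 x y ne; rewrite !ltNge; apply: contra.
by have -> := eq_comparisons _ _ (false, (x, r.1.2 x)) (false, (x, y)) e.
Qed.

Lemma exclusive_responds : exclusive responds.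
Proof.
move=> [[f g] a] [[f' g'] a'] w [[/= H1 H2] aw] [[/= H1' H2'] aw'].
congr (_, _, _); last by rewrite -aw.
- apply/ffunP => y; apply/eqP; apply: contraT => ne.
  have := lt_trans (H1' _ _ ne) (H1 (f' y) y _); rewrite ltxx; apply.
  by rewrite eq_sym.
- apply/ffunP => x; apply/eqP; apply: contraT => ne.
  have := lt_trans (H2' _ _ ne) (H2 x (g' x) _); rewrite ltxx; apply.
  by rewrite eq_sym.
Qed.

Section Cells.
Variables (N : nat) (c : R -> 'I_N.+1).
Hypothesis mc : forall j, measurable (c @^-1` [set j]).
Hypothesis muc : forall j, mu (c @^-1` [set j]) = (N.+1%:R^-1)%:E.
Hypothesis c_lt : forall u v, (c u < c v)%N -> u < v.
Local Notation pattern := {ffun J -> 'I_N.+1}.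

(** The nested intersections match [game_independent] literally. *)
Definition cell_event (g : pattern) (a : 'I_m1 * 'I_m2) : set T :=
  \big[setI/setT]_(i < m1) \big[setI/setT]_(j < m2)
     (U1 i j @^-1` (c @^-1` [set g (true, (i, j))]) `&`
      U2 i j @^-1` (c @^-1` [set g (false, (i, j))])) `&` A0 @^-1` [set a].

Lemma cell_eventP g a w :
  cell_event g a w <-> (forall i, c (payoff i w) = g i) /\ A0 w = a.
Proof.
split=> [[/bigsetI_ordP H aw]|[H aw]]; split=> //.
  by move=> [[] [x y]]; have /bigsetI_ordP/(_ y)[] := H x.
by apply/bigsetI_ordP => x; apply/bigsetI_ordP => y; split;
  [apply: (H (true, (x, y)))|apply: (H (false, (x, y)))].
Qed.

Lemma measurable_cell_event g a : measurable (cell_event g a).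
Proof.
apply: measurableI; last exact: mA0.
apply: bigsetI_measurable => i _; apply: bigsetI_measurable => j _.
by apply: measurableI; rewrite -[X in measurable X]setTI; [apply: mU1|apply: mU2].
Qed.

Lemma probability_cell_event g a :
  P (cell_event g a) = ((#|{: pattern}| * #|{: 'I_m1 * 'I_m2}|)%:R^-1)%:E.
Proof.
rewrite /cell_event indep // lawA0.
under eq_bigr do under eq_bigr do rewrite lawU1 // lawU2 // !muc -EFinM.
under eq_bigr do rewrite prodEFin prodr_const card_ord.
rewrite prodEFin prodr_const card_ord -EFinM; congr EFin.
rewrite card_ffun !card_prod card_bool !card_ord [in RHS]natrM [in RHS]invfM;
  congr (_ * _).
rewrite natrX -exprVn -expr2 -!exprM; congr (_ ^+ _); lia.
Qed.

(** Strictly ordered cells contain strictly ordered payoffs, so the disjoint cell events of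
    dominated patterns all lie in [responds r]. *)
Lemma cell_responds_ge (r : response) :
  (((#|dominates N r.1|)%:R / (#|{: pattern}| * #|{: 'I_m1 * 'I_m2}|)%:R)%:E
    <= P (responds r))%E.
Proof.
have ex : exclusive (cell_event^~ r.2).
  move=> g g' w /cell_eventP[H _] /cell_eventP[H' _].
  by apply/ffunP => i; rewrite -H -H'.
have sub g : dominates N r.1 g -> cell_event g r.2 `<=` responds r.
  move=> /dominatesP[H1 H2] w /cell_eventP[H aw]; split=> //; split=> x y ne.
    apply: c_lt; have -> := H (true, (x, y)); have -> := H (true, (r.1.1 y, y)).
    exact: H1.
  apply: c_lt; have -> := H (false, (x, y)); have -> := H (false, (x, r.1.2 x)).
  exact: H2.
apply: le_trans (sum_probability_le P _ _ _ (measurable_cell_event^~ r.2)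
  ex (measurable_responds r) sub).
under eq_bigr do rewrite probability_cell_event.
by rewrite sumEFin sumr_const mulr_natl.
Qed.

End Cells.

Lemma responds_ge (r : response) : ((#|{: response}|%:R^-1)%:E <= P (responds r))%E.
Proof.
have K0 : 0 < #|{: response}|%:R :> R.
  by rewrite ltr0n; apply/card_gt0P; exists r.
rewrite -[P _]fineK ?fin_num_measure //; last exact: measurable_responds.
set p := fine _; rewrite lee_fin -[leLHS]mul1r ler_pdivrMr // leNgt.
apply/negP => lt1; pose C : R := #|{: J}|%:R * #|{: J}|%:R.
pose e := 1 - p * #|{: response}|%:R; have e0 : 0 < e by rewrite subr_gt0.
(* [e] is the supposed deficit; this [N] pushes the bound [C / N.+1] on the proportion of ties below
   [e]. *)
pose N := Num.truncn (C / e).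
have [c [mc muc c_lt]] := quantile_cells mu atomless N.
have := cell_responds_ge N c mc muc c_lt r.
rewrite -[P _]fineK ?fin_num_measure //; last exact: measurable_responds.
rewrite -/p lee_fin.
set G := #|{: {ffun J -> 'I_N.+1}}|; set M := #|{: 'I_m1 * 'I_m2}| => le_p.
have G0 : 0 < G%:R :> R.
  by rewrite ltr0n; apply/card_gt0P; exists [ffun=> ord0].
have M0 : 0 < M%:R :> R by rewrite ltr0n; apply/card_gt0P; exists r.2.
have := card_dominates N m1_gt0 m2_gt0 r.1; rewrite -/G.
set FG := #|{: {ffun 'I_m2 -> 'I_m1} * {ffun 'I_m1 -> 'I_m2}}|;
  set D := #|dominates N r.1| in le_p *.
rewrite -(ler_nat R) natrD !natrM -/C.
have KE : #|{: response}| = (FG * M)%N by rewrite /FG /M -card_prod.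
have le_p' : D%:R * FG%:R <= p * #|{: response}|%:R * G%:R.
  have -> : p * #|{: response}|%:R * G%:R = p * (G * M)%:R * FG%:R :> R.
    by rewrite KE !natrM; ring.
  by rewrite ler_wpM2r // -ler_pdivrMr // natrM mulr_gt0.
have N1 : C < e * N.+1%:R by rewrite -ltr_pdivrMl // mulrC truncnS_gt.
apply/negP; rewrite -ltNge.
(* The two terms on the right of [card_dominates] are at most [1 - e] and less than [e] times
   [G * N.+1], a contradiction. *)
have lt2 : FG%:R * D%:R * N.+1%:R <= (1 - e) * G%:R * N.+1%:R.
  rewrite ler_pM2r ?ltr0n // mulrC.
  by rewrite /e opprB addrCA subrr addr0.
apply: le_lt_trans (lerD lt2 (lexx _)) _.
have -> : G%:R * N.+1%:R = (1 - e) * G%:R * N.+1%:R + e * N.+1%:R * G%:R :> R by ring.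
by rewrite ltrD2l ltr_pM2r.
Qed.

Lemma probability_converges k : (0 < k <= minn m1 m2)%N ->
  P [set w | converges_to_cycle (clockwork (fun x y => U1 x y w) (fun x y => U2 x y w) (A0 w)) k]
  = (#|@converging m1 m2 k|%:R / #|{: response}|%:R)%:E.
Proof.
move=> kP; apply: (probability_uniform P responds).
- apply/card_gt0P.
  by exists ([ffun=> Ordinal m1_gt0], [ffun=> Ordinal m2_gt0], (Ordinal m1_gt0, Ordinal m2_gt0)).
- exact: measurable_responds.
- exact: exclusive_responds.
- exact: responds_ge.
(* The events [responds] do not cover ties, so measurability goes through the comparisons. *)
- apply: (measurable_determined comparisons _ measurable_comparisons) => w w' e /=.
  have eA : A0 w = A0 w' by case: e.
  have eC t : clockwork (fun x y => U1 x y w) (fun x y => U2 x y w) (A0 w) t =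
      clockwork (fun x y => U1 x y w') (fun x y => U2 x y w') (A0 w') t.
    rewrite eA; apply: eq_clockwork => [x x' y|x y y'].
      exact: (eq_comparisons _ _ (true, (x, y)) (true, (x', y)) e).
    exact: (eq_comparisons _ _ (false, (x, y)) (false, (x, y')) e).
  by move=> [tau [tau0 h ne]]; exists tau; split=> [//||k' k'0 k'k]; rewrite -!eC;
    auto.
- by move=> r conv w [strict aw] /=; rewrite aw; apply/converges_to_cycleP.
- move=> r nconv w [strict aw] /=;
  rewrite aw => /(converges_to_cycleP _ _ _ strict _ kP).
  exact/negP.
Qed.

End RandomGame.

Theorem corollary2 (d : measure_display) (T : measurableType d) (R : realType)
  (P : probability T R) (m1 m2 : nat)
  (U1 U2 : 'I_m1 -> 'I_m2 -> T -> R) (A0 : T -> ('I_m1 * 'I_m2)%type)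
  (mu : probability R R) (k : nat) :
  (2 <= m1)%N -> (2 <= m2)%N ->
  (forall i j, measurable_fun setT (U1 i j)) ->
  (forall i j, measurable_fun setT (U2 i j)) ->
  (forall S : set ('I_m1 * 'I_m2), measurable (A0 @^-1` S)) ->
  (forall x : R, mu [set x] = 0%E) ->
  (forall i j (B : set R), measurable B -> P (U1 i j @^-1` B) = mu B) ->
  (forall i j (B : set R), measurable B -> P (U2 i j @^-1` B) = mu B) ->
  (forall a, P (A0 @^-1` [set a]) = ((m1 * m2)%:R^-1)%:E) ->
  game_independent P U1 U2 A0 ->
  (1 <= k)%N -> (k <= minn m1 m2)%N ->
  P [set w | converges_to_cycle
               (clockwork (fun x y => U1 x y w) (fun x y => U2 x y w) (A0 w)) k]
  = (\sum_(1 <= t < (2 * (minn m1 m2 - k + 1)).+1)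
       ((mm m1 m2 (sc (t + 2 * k - 1)))%:R^-1 *
        \prod_(1 <= i < (t + 2 * k - 2).+1)
          (1 - (mm m1 m2 (sc i))%:R^-1 * (i./2)%:R)))%:E.
Proof.
move=> /ltnW m1_gt0 /ltnW m2_gt0 mU1 mU2 mA0 atomless lawU1 lawU2 lawA0 indep k0 km.
have kP : (0 < k <= minn m1 m2)%N by rewrite k0.
rewrite (probability_converges P m1 m2 U1 U2 A0 mu) // card_converging //.
rewrite mulrAC divff ?mul1r // pnatr_eq0 -lt0n; apply/card_gt0P.
by exists ([ffun=> Ordinal m1_gt0], [ffun=> Ordinal m2_gt0], (Ordinal m1_gt0, Ordinal m2_gt0)).
Qed.
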